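(* Consider the sequential probability ratio test (SPRT) of $H_0:\theta\le\theta_0$ versus $H_1:\theta\ge\theta_1$ ($\theta_0<\theta_1$) with thresholds $k_0\in(0,1)$, $k_1\in(1,\infty)$, for i.i.d. samples from an exponential family with density $h(x)\exp(\eta(\theta)x-\psi(\theta))$, $\eta'(\theta)>0$, $\psi'(\theta)/\eta'(\theta)=\theta$. Define $$u(n)=\frac{\psi(\theta_1)-\psi(\theta_0)-\frac1n\ln k_1}{\eta(\theta_1)-\eta(\theta_0)},\qquad v(n)=\frac{\psi(\theta_1)-\psi(\theta_0)-\frac1n\ln k_0}{\eta(\theta_1)-\eta(\theta_0)},\qquad n=1,2,\dots.$$ Let $\mathbf n$ denote the number of samples at the termination of the sampling process of the SPRT. For a positive integer $m$ write $u=u(m)$, $v=v(m)$. For $\epsilon>0$, the following statements hold true: (i) $$\Pr\{\text{Accept }H_0,\ \mathbf n\le m\mid\theta\}\le\Pr\{\text{Accept }H_0\mid\theta\}\le\Pr\{\text{Accept }H_0,\ \mathbf n\le m\mid\theta\}+\epsilon,$$ $$\Pr\{\text{Accept }H_1,\ \mathbf n\le m\mid\theta\}\le\Pr\{\text{Accept }H_1\mid\theta\}\le\Pr\{\text{Accept }H_1,\ \mathbf n\le m\mid\theta\}+\epsilon$$ provided that $$\theta<u,\ \left[\frac{\exp(\eta(\theta)u-\psi(\theta))}{\exp(\eta(u)u-\psi(u))}\right]^m<\epsilon\qquad\text{or}\qquad\theta>v,\ \left[\frac{\exp(\eta(\theta)v-\psi(\theta))}{\exp(\eta(v)v-\psi(v))}\right]^m<\epsilon.$$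 (ii) $$\sum_{n=1}^{m-1}\Pr\{\mathbf n>n\}\le\mathbb E[\mathbf n]\le\sum_{n=1}^{m-1}\Pr\{\mathbf n>n\}+\epsilon$$ provided that $$\theta<u,\qquad\left[\frac{\exp(\eta(\theta)u-\psi(\theta))}{\exp(\eta(u)u-\psi(u))}\right]^m<\epsilon\left[1-\frac{\exp(\eta(\theta)u-\psi(\theta))}{\exp(\eta(u)u-\psi(u))}\right]$$ or $$\theta>v,\qquad\left[\frac{\exp(\eta(\theta)v-\psi(\theta))}{\exp(\eta(v)v-\psi(v))}\right]^m<\epsilon\left[1-\frac{\exp(\eta(\theta)v-\psi(\theta))}{\exp(\eta(v)v-\psi(v))}\right].$$
   Context: $X_1,X_2,\dots$ are i.i.d. samples of $X$ with density function $f_X(x,\theta)=h(x)\exp(\eta(\theta)x-\psi(\theta))$ in an exponential family for which $\eta'(\theta)>0$ and $\psi'(\theta)/\eta'(\theta)=\theta$; $\theta_0<\theta_1$ are parametric values. The SPRT observes $X_1,X_2,\dots$ sequentially; after $n$ samples ($n=1,2,\dots$) it forms $R_n=\prod_{i=1}^nf_X(X_i,\theta_0)\big/\prod_{i=1}^nf_X(X_i,\theta_1)$ and: rejects $H_0$ (accepts $H_1$) if $R_n\le k_0$; accepts $H_0$ if $R_n\ge k_1$; continues sampling if $k_0<R_n<k_1$. $\Pr\{\cdot\mid\theta\}$ is probability when the true parameter is $\theta$; in (ii) probabilities and expectation are taken under $\theta$.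
   Formalization: In (ii) both sums run from n=0 to m-1 instead of n=1 to m-1: since Pr{n>0}=1, E[n] is at least 1 plus the printed sum, so the printed upper bound fails for every admissible ε<1. *)

(* Defs.v *)
From HB Require Import structures.
From mathcomp Require Import all_boot all_order all_algebra finmap.
From mathcomp Require Import all_classical all_reals all_analysis.
Set Implicit Arguments.
Unset Strict Implicit.
Unset Printing Implicit Defensive.
Import Order.TTheory GRing.Theory Num.Theory.
Import numFieldNormedType.Exports.
Local Open Scope classical_set_scope.
Local Open Scope ring_scope.

Section exponential_family.
Context {R : realType}.
Implicit Types (h eta psi : R -> R) (Theta : set R).

Definition expfam_density h eta psi (x theta : R) : R :=
  h x * expR (eta theta * x - psi theta).

(* Densities are taken with respect to a sigma-finite measure [mu]: Lebesgue
   measure for probability density functions, counting measure on a countable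
   set for probability mass functions. *)
Record exponential_family
    (mu : {sigma_finite_measure set (measurableTypeR R) -> \bar R})
    Theta h eta psi : Prop := ExponentialFamily {
  expfam_interval : is_interval Theta ;
  expfam_measurable : measurable_fun setT h ;
  expfam_ge0 : forall x, 0 <= h x ;
  expfam_normalized : forall theta, Theta theta ->
    (\int[mu]_x (expfam_density h eta psi x theta)%:E = 1)%E ;
  expfam_derivable_eta : forall theta, Theta theta -> derivable eta theta 1 ;
  expfam_derivable_psi : forall theta, Theta theta -> derivable psi theta 1 ;
  expfam_eta_gt0 : forall theta, Theta theta -> 0 < eta^`()%classic theta ;
  expfam_mean : forall theta, Theta theta ->
    psi^`()%classic theta / eta^`()%classic theta = theta }.

End exponential_family.

Section iid_samples.
Context {R : realType} {d : measure_display} {T : measurableType d}.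
Implicit Types (P : probability T R) (X : nat -> {mfun T >-> R}).

Definition mutually_independent P X : Prop :=
  forall (J : {fset nat}) (A : nat -> set R), (forall i, measurable (A i)) ->
    P (\bigcap_(i in [set` J]) (X i @^-1` A i)) =
    (\prod_(i <- J) P (X i @^-1` A i))%E.

Definition has_density
    (mu : {sigma_finite_measure set (measurableTypeR R) -> \bar R})
    P (Y : {mfun T >-> R}) (g : R -> R) : Prop :=
  forall A : set R, measurable A ->
    P (Y @^-1` A) = (\int[mu]_(x in A) (g x)%:E)%E.

Definition iid_with_density
    (mu : {sigma_finite_measure set (measurableTypeR R) -> \bar R})
    P X (g : R -> R) : Prop :=
  mutually_independent P X /\ forall i, has_density mu P (X i) g.

End iid_samples.

Section sprt.
Context {R : realType} {d : measure_display} {T : measurableType d}.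
Variables (f : R -> R -> R) (X : nat -> {mfun T >-> R}).
Variables (theta0 theta1 k0 k1 : R).

(* The samples are indexed from 0, so the first n samples are the X i with
   i < n.  The quotient 0 / 0 = 0 can only arise on an event of probability
   zero under the parameters of interest. *)
Definition sprt_ratio (n : nat) (w : T) : R :=
  (\prod_(i < n) f (X i w) theta0) / (\prod_(i < n) f (X i w) theta1).

Definition sprt_continue (n : nat) (w : T) : Prop :=
  k0 < sprt_ratio n w < k1.

Definition sprt_stop (n : nat) (w : T) : Prop :=
  [/\ (0 < n)%N,
      forall j, (0 < j < n)%N -> sprt_continue j w &
      ~ sprt_continue n w].

(* There is at most one stopping index; if there is none, the infimum of the
   empty set gives +oo. *)
Definition sprt_samples (w : T) : \bar R :=
  ereal_inf [set (n%:R)%:E | n in [set n | sprt_stop n w]].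

Definition sprt_accept_H0 : set T :=
  [set w | exists n, sprt_stop n w /\ k1 <= sprt_ratio n w].

Definition sprt_accept_H1 : set T :=
  [set w | exists n, sprt_stop n w /\ sprt_ratio n w <= k0].

End sprt.

Section truncation.
Context {R : realType}.
Variables (eta psi : R -> R).

(* [sprt_bound theta0 theta1 k1] is u and [sprt_bound theta0 theta1 k0] is v. *)
Definition sprt_bound (theta0 theta1 k : R) (n : nat) : R :=
  (psi theta1 - psi theta0 - n%:R^-1 * ln k) / (eta theta1 - eta theta0).

Definition chernoff_ratio (theta z : R) : R :=
  expR (eta theta * z - psi theta) / expR (eta z * z - psi z).

End truncation.

(* Main.v *)
(* As long as sampling continues past stage n, k0 < R_n < k1, and R_n is the
   exponential of an affine function of the sample sum S_n; hence {N > n} is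
   contained in n u(n) < S_n < n v(n).  Since k0 < 1 < k1, u is nondecreasing and
   v nonincreasing in n, so for n >= m these bounds hold with u = u(m) and
   v = v(m).  If theta < u (resp. theta > v), Chernoff's bound with exponent
   eta(z) - eta(theta), z = u (resp. z = v), gives P(N > n) <= c(z)^n with c the
   ratio in the statement.  The tilted parameter z lies in the parameter interval
   because (psi(theta1) - psi(theta0)) / (eta(theta1) - eta(theta0)) lies between
   theta0 and theta1, so that theta < u < theta1 or theta0 < v < theta.  Part (i)
   follows with n = m, and part (ii) by summing the geometric tail of
   E[N] = sum_n P(N > n). *)
Require Import Defs.
From HB Require Import structures.
From mathcomp Require Import all_boot all_order all_algebra finmap.
From mathcomp Require Import all_classical all_reals all_analysis.
From mathcomp Require Import measurable_realfun ring lra.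
Import Order.TTheory GRing.Theory Num.Theory.
Import numFieldNormedType.Exports.
Local Open Scope classical_set_scope.
Local Open Scope ring_scope.
Import HBNNSimple.

(** * Change of variables for weighted image measures *)

(** Monotone convergence along the simple approximations of [phi]. The point of the right-hand side
    is that it sees [m], [Y] and [F] only through the image under [Y] of the measure with density
    [F]. *)
Lemma integral_mul_comp_lim d d' (T : measurableType d) (S : measurableType d')
    (R : realType) (m : {measure set T -> \bar R}) (Y : T -> S) (F : T -> R)
    (phi : S -> R) :
  measurable_fun setT Y -> measurable_fun setT F -> (forall x, 0 <= F x) ->
  forall mphi : measurable_fun [set: S] (EFin \o phi : S -> \bar R),
  (forall y, 0 <= phi y) ->
  (\int[m]_x (F x * phi (Y x))%:E =
   limn (fun n => \sum_(k \in range (nnsfun_approx measurableT mphi n))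
     (k%:E * \int[m]_(x in Y @^-1`
                           (nnsfun_approx measurableT mphi n @^-1` [set k]))
        (F x)%:E)))%E.
Proof.
move=> mY mF F0 mphi phi0.
pose a := nnsfun_approx measurableT mphi.
have mYA A : measurable A -> measurable (Y @^-1` A).
  by move=> mA; rewrite -[_ @^-1` _]setTI; exact: mY.
transitivity (limn (fun n => \int[m]_x (F x * a n (Y x))%:E)%E).
  rewrite -monotone_convergence//.
  - apply: eq_integral => x _; apply/esym/cvg_lim => //.
    under eq_fun do rewrite EFinM.
    rewrite EFinM; apply: cvgeZl => //.
    apply: (@cvg_nnsfun_approx _ _ _ _ measurableT _ mphi) => // y _ /=.
    by rewrite lee_fin.
  - move=> n; apply/measurable_EFinP/measurable_funM => //.
    exact: measurableT_comp.
  - by move=> n x _; rewrite lee_fin mulr_ge0.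
  - move=> x _ p q pq; rewrite lee_fin ler_wpM2l//.
    by have /lefP := nd_nnsfun_approx measurableT mphi pq; exact.
congr (limn _); apply/funext => n.
pose G k x := (k * \1_(a n @^-1` [set k]) (Y x) * F x)%:E.
transitivity (\int[m]_x (\sum_(k \in range (a n)) G k x))%E.
  apply: eq_integral => x _; rewrite /G fsumEFin//; congr EFin.
  rewrite mulrC fimfunE fsbig_finite//= fsbig_finite//= mulr_suml.
  exact: eq_bigr.
rewrite ge0_integral_fsum//.
- apply: eq_fsbigr => k /set_mem[y _ aky].
  have k0 : 0 <= k by rewrite -aky.
  transitivity (\int[m]_x (k%:E * ((F x)%:E *
      (\1_(Y @^-1` (a n @^-1` [set k])) x)%:E)))%E.
    apply: eq_integral => x _; rewrite /G -!EFinM -mulrA; congr (k * _)%:E.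
    by rewrite mulrC.
  have mk : measurable (Y @^-1` (a n @^-1` [set k])) by exact: mYA.
  rewrite ge0_integralZl//; last first.
  + by move=> x _; rewrite -EFinM lee_fin mulr_ge0.
  + by apply/measurable_EFinP/measurable_funM => //; exact: measurable_indic.
  + by rewrite [in RHS]integral_mkcond epatch_indic.
- move=> k; apply/measurable_EFinP/measurable_funM => //.
  apply: measurable_funM => //.
  have -> : (fun x => \1_(a n @^-1` [set k]) (Y x)) =
    \1_(Y @^-1` (a n @^-1` [set k])) :> (T -> R) by [].
  by apply: measurable_indic; apply: mYA.
- move=> k x _; rewrite lee_fin mulr_ge0// -lee_fin EFinM.
  exact: nnfun_muleindic_ge0.
Qed.

(** Agreement on indicators extends to all nonnegative measurable [phi], because both limits of
    simple integrals coincide term by term. It serves twice: to factor expectations under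
    independence, and to pass from the law of a sample to its density. *)
Lemma eq_integral_mul_comp d1 d2 d' (T1 : measurableType d1)
    (T2 : measurableType d2) (S : measurableType d') (R : realType)
    (m1 : {measure set T1 -> \bar R}) (m2 : {measure set T2 -> \bar R})
    (Y1 : T1 -> S) (Y2 : T2 -> S) (F1 : T1 -> R) (F2 : T2 -> R) (phi : S -> R) :
  measurable_fun setT Y1 -> measurable_fun setT Y2 ->
  measurable_fun setT F1 -> measurable_fun setT F2 ->
  (forall x, 0 <= F1 x) -> (forall x, 0 <= F2 x) ->
  (forall A, measurable A -> (\int[m1]_(x in Y1 @^-1` A) (F1 x)%:E =
                              \int[m2]_(x in Y2 @^-1` A) (F2 x)%:E)%E) ->
  measurable_fun setT phi -> (forall y, 0 <= phi y) ->
  (\int[m1]_x (F1 x * phi (Y1 x))%:E = \int[m2]_x (F2 x * phi (Y2 x))%:E)%E.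
Proof.
move=> mY1 mY2 mF1 mF2 F10 F20 F12 /measurable_EFinP mphi phi0.
rewrite (integral_mul_comp_lim _ _ _ _ _ m1 Y1 F1 phi mY1 mF1 F10 mphi phi0).
rewrite (integral_mul_comp_lim _ _ _ _ _ m2 Y2 F2 phi mY2 mF2 F20 mphi phi0).
congr (limn _); apply/funext => n; apply: eq_fsbigr => k _.
by rewrite F12.
Qed.

(** * Expectations of products of independent variables *)

Section independence.
Context {R : realType} {d : measure_display} {T : measurableType d}.
Variables (P : probability T R) (X : nat -> {mfun T >-> R}).
Hypothesis indepX : mutually_independent P X.

Lemma mutually_independent_ord n (A : nat -> set R) :
  (forall i, measurable (A i)) ->
  P (\bigcap_(i < n) (X i @^-1` A i)) = (\prod_(i < n) P (X i @^-1` A i))%E.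
Proof.
move=> mA; pose J := [fset i in iota 0 n]%fset.
have JE i : (i \in J) = (i < n)%N by rewrite !inE mem_iota.
rewrite -(big_mkord xpredT (fun i => P (X i @^-1` A i))).
have -> : (\prod_(0 <= i < n) P (X i @^-1` A i) =
           \prod_(i <- J) P (X i @^-1` A i))%E.
  apply: perm_big; apply: uniq_perm; rewrite ?iota_uniq ?fset_uniq// => i.
  by rewrite JE mem_index_iota.
rewrite -indepX//; congr (P _); apply: eq_bigcapl.
by split => i /=; rewrite JE.
Qed.

Lemma expectation_prod_independent n (G : nat -> R -> R) (e : nat -> R) :
  (forall i, measurable_fun setT (G i)) -> (forall i x, 0 <= G i x) ->
  (forall i, \int[P]_w (G i (X i w))%:E = (e i)%:E)%E ->
  (\int[P]_w (\prod_(i < n) G i (X i w))%:E = (\prod_(i < n) e i)%:E)%E.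
Proof.
(* The factors are turned from indicators into the [G i] one at a time. *)
suff H k : forall (G : nat -> R -> R) (e : nat -> R),
  (forall i, measurable_fun setT (G i)) -> (forall i x, 0 <= G i x) ->
  (forall i, \int[P]_w (G i (X i w))%:E = (e i)%:E)%E ->
  (forall i, (k <= i < n)%N -> exists2 A, measurable A & G i = \1_A) ->
  (\int[P]_w (\prod_(i < n) G i (X i w))%:E = (\prod_(i < n) e i)%:E)%E.
  move=> mG G0 Ge; apply: (H n) => // i /andP[ni].
  by rewrite ltnNge ni.
elim: k => {G e} [|k IH] G e mG G0 Ge Gind.
  (* Base case: every factor below [n] is an indicator, so the product is the indicator of an
     intersection. Indices from [n] on receive the empty set as a dummy value. *)
  have /all_sig[A /all_and2[mA GA]] : forall i,
      {A | measurable A /\ ((i < n)%N -> G i = \1_A)}.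
    move=> i; apply: cid; have [/Gind[A mA ->]|_] := boolP (i < n)%N.
      by exists A.
    by exists set0.
  have PA i : (i < n)%N -> P (X i @^-1` A i) = (e i)%:E.
    move=> ni; rewrite -Ge GA// -[_ @^-1` _]setIT -integral_indic//.
    exact: measurable_funPTI.
  have mXA i : measurable (X i @^-1` A i) by exact: measurable_funPTI.
  transitivity (P (\bigcap_(i < n) (X i @^-1` A i))).
    rewrite -[X in P X]setIT -integral_indic//; last exact: bigcap_measurableType.
    apply: eq_integral => w _; congr EFin.
    rewrite bigcap_mkord.
    rewrite (big_morph (fun B : set T => \1_B w : R) (id1 := 1) (op1 := *%R)).
    - by apply: eq_bigr => i _; rewrite GA.
    - by move=> B C; rewrite indicI.
    - by rewrite indicT.
  rewrite mutually_independent_ord// -prodEFin.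
  by apply: eq_bigr => i _; rewrite PA.
have [nk|kn] := leqP n k.
  apply: IH => // i /andP[ki ni].
  by move: (leq_trans ni nk); rewrite ltnNge ki.
pose F w := \prod_(i < n | i != Ordinal kn) G i (X i w).
pose C := \prod_(i < n | i != Ordinal kn) e i.
have e0 i : 0 <= e i.
  by rewrite -lee_fin -Ge; apply: integral_ge0 => w _; rewrite lee_fin.
have mGX i : measurable_fun setT (fun w => G i (X i w)).
  exact: measurableT_comp.
transitivity (\int[P]_w (F w * G k (X k w))%:E)%E.
  by apply: eq_integral => w _; rewrite (bigD1 (Ordinal kn))//= mulrC.
rewrite (bigD1 (Ordinal kn))//= -/C.
rewrite (eq_integral_mul_comp _ _ _ T T _ R P P (X k) (X k) F (cst C) (G k))//.
- rewrite -[LHS]/(\int[P]_w (C%:E * (G k (X k w))%:E))%E.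
  rewrite ge0_integralZl//.
  + by rewrite Ge mulrC EFinM.
  + exact/measurable_EFinP.
  + by move=> w _; rewrite lee_fin.
  + by rewrite lee_fin; apply: prodr_ge0.
- have -> : F = fun w => \prod_(i <- [seq i <- index_enum 'I_n | i != Ordinal kn])
      G (val i) (X (val i) w).
    by apply/funext => w; rewrite big_filter.
  exact: measurable_prod.
- by move=> w; apply: prodr_ge0.
- by move=> w; apply: prodr_ge0.
move=> B mB.
have mXB : measurable (X k @^-1` B) by exact: measurable_funPTI.
(* With [\1_B] in place of the factor [k], all factors from [k] on are indicators and the induction
   hypothesis applies. *)
pose GB i := if i == k then \1_B else G i.
pose eB i := if i == k then fine (P (X k @^-1` B)) else e i.
have GBk : GB k = \1_B by rewrite /GB eqxx.
have eBk : (eB k)%:E = P (X k @^-1` B).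
  by rewrite /eB eqxx fineK ?fin_num_measure.
have GBD i : i != k -> GB i = G i by rewrite /GB => /negbTE ->.
have eBD i : i != k -> eB i = e i by rewrite /eB => /negbTE ->.
transitivity (\int[P]_w (\prod_(i < n) GB i (X i w))%:E)%E.
  rewrite integral_mkcond epatch_indic; apply: eq_integral => w _.
  rewrite (bigD1 (Ordinal kn))//= GBk -EFinM mulrC; congr (_ * _)%:E.
  by apply: eq_bigr => i ik; rewrite GBD.
rewrite (IH _ eB).
- rewrite -[RHS]/(\int[P]_(w in X k @^-1` B) (cst C%:E w))%E.
  rewrite integral_cst//= (bigD1 (Ordinal kn))//= /eB eqxx mulrC EFinM.
  rewrite fineK ?fin_num_measure//; congr (_%:E * _)%E.
  by apply: eq_bigr => i ik; exact: eBD.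
- by move=> i; rewrite /GB; case: ifP.
- by move=> i x; rewrite /GB; case: ifP.
- move=> i; rewrite /GB /eB; case: eqP => // ->.
  rewrite fineK ?fin_num_measure// -[in RHS](setIT (_ @^-1` _)).
  by rewrite -integral_indic.
- move=> i /andP[ki ni]; rewrite /GB; case: eqP => [_|/eqP ik]; first by exists B.
  by apply: Gind; rewrite ni ltn_neqAle eq_sym ik ki.
Qed.

End independence.

(** * Exponential tilting and Chernoff's bound *)

Section chernoff_bound.
Context {R : realType}.
Variable mu : {sigma_finite_measure set (measurableTypeR R) -> \bar R}.
Variables (Theta : set R) (h eta psi : R -> R).
Hypothesis hfam : exponential_family mu Theta h eta psi.

Lemma measurable_expfam_density theta :
  measurable_fun setT (fun x => expfam_density h eta psi x theta).
Proof.
apply: measurable_funM; first exact: expfam_measurable hfam.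
by apply: measurableT_comp => //; exact: measurable_funB.
Qed.

Lemma expfam_density_ge0 x theta : 0 <= expfam_density h eta psi x theta.
Proof. by rewrite mulr_ge0 ?expR_ge0//; exact: expfam_ge0 hfam _. Qed.

Lemma chernoff_ratioE theta z :
  chernoff_ratio eta psi theta z =
  expR (psi z - psi theta - (eta z - eta theta) * z).
Proof. by rewrite /chernoff_ratio -expRN -expRD; congr expR; ring. Qed.

(** The exponential factor turns the density at [theta] into [expR (psi z - psi theta)] times the
    density at [z], which integrates to 1 because [z] belongs to [Theta]. *)
Lemma expfam_mgf d (T : measurableType d) (P : probability T R)
    (Y : {mfun T >-> R}) theta z :
  Theta z -> has_density mu P Y (fun x => expfam_density h eta psi x theta) ->
  (\int[P]_w (expR ((eta z - eta theta) * Y w))%:E =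
   (expR (psi z - psi theta))%:E)%E.
Proof.
move=> zT hY.
(* The law of [Y] under [P] with weight 1 is matched with the identity under [mu], weighted by the
   density. *)
have /= := eq_integral_mul_comp _ _ _ T (measurableTypeR R) _ R P mu Y id (cst 1)
  (fun x => expfam_density h eta psi x theta)
  (fun x => expR ((eta z - eta theta) * x)).
under eq_integral do rewrite mul1r.
move=> ->//.
- transitivity (\int[mu]_x ((expR (psi z - psi theta))%:E *
      (expfam_density h eta psi x z)%:E))%E.
    apply: eq_integral => x _; rewrite -EFinM; congr EFin.
    rewrite /expfam_density mulrCA -!mulrA -!expRD; congr (_ * expR _); ring.
  rewrite ge0_integralZl//.
  + by rewrite (expfam_normalized hfam)// mule1.
  + by apply/measurable_EFinP; exact: measurable_expfam_density.
  + by move=> x _; rewrite lee_fin expfam_density_ge0.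
- exact: measurable_expfam_density.
- by move=> x; exact: expfam_density_ge0.
- move=> A mA; rewrite -hY// -[LHS]/(\int[P]_(w in Y @^-1` A) (cst 1%:E w))%E.
  by rewrite integral_cst ?mul1e//; exact: measurable_funPTI.
- by apply: measurableT_comp => //; exact: measurable_funM.
Qed.

(** Markov's inequality: on [E] the product of the variables [G i (X i w)] is at least 1, and by
    independence its mean is the power of the Chernoff ratio. The sign condition on a product covers
    the upper and the lower tail at once. *)
Lemma expfam_chernoff d (T : measurableType d) (P : probability T R)
    (X : nat -> {mfun T >-> R}) theta z n (E : set T) :
  Theta z ->
  iid_with_density mu P X (fun x => expfam_density h eta psi x theta) ->
  measurable E ->
  (forall w, E w ->
     0 <= (eta z - eta theta) * (\sum_(i < n) X i w - n%:R * z)) ->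
  (P E <= (chernoff_ratio eta psi theta z ^+ n)%:E)%E.
Proof.
move=> zT [indepX densX] mE hE.
pose G (i : nat) x := expR ((eta z - eta theta) * (x - z)).
have mG i : measurable_fun setT (G i).
  apply: measurableT_comp => //; apply: measurable_funM => //.
  exact: measurable_funB.
have -> : chernoff_ratio eta psi theta z ^+ n =
    \prod_(i < n) chernoff_ratio eta psi theta z.
  by rewrite prodr_const card_ord.
rewrite -(expectation_prod_independent _ _ indepX n G
  (fun=> chernoff_ratio eta psi theta z))//; last first.
- move=> i; rewrite chernoff_ratioE expRD EFinM muleC.
  rewrite -(expfam_mgf _ _ P (X i) theta z)// -ge0_integralZl//.
  + apply: eq_integral => w _; rewrite -EFinM -expRD; congr (expR _)%:E; ring.
  + apply/measurable_EFinP; apply: measurableT_comp => //.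
    exact: measurable_funM.
- by move=> i x; exact: expR_ge0.
rewrite -[E in P E]setIT -integral_indic//.
apply: ge0_le_integral => //.
- exact/measurable_EFinP/measurable_indic.
- apply/measurable_EFinP.
  apply: (@measurable_prod _ _ _ _ _ _ (fun (i : 'I_n) w => G i (X i w))) => i _.
  exact: measurableT_comp.
move=> w _; rewrite lee_fin indicE; have [/set_mem Ew|_] := boolP (w \in E).
  rewrite -expR_sum -[leLHS]expR0 ler_expR.
  rewrite -mulr_sumr sumrB sumr_const card_ord -mulr_natl; exact: hE.
by apply: prodr_ge0 => i _; exact: expR_ge0.
Qed.

End chernoff_bound.

(** * Location and monotonicity of the bounds u and v; the likelihood ratio as a function of the
    sample sum *)

Section parameters.
Context {R : realType}.
Variable mu : {sigma_finite_measure set (measurableTypeR R) -> \bar R}.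
Variables (Theta : set R) (h eta psi : R -> R).
Hypothesis hfam : exponential_family mu Theta h eta psi.
Variables a b : R.
Hypotheses (aT : Theta a) (bT : Theta b) (ab : a < b).

Lemma expfam_itv x : a <= x <= b -> Theta x.
Proof. by move=> axb; apply: (expfam_interval hfam) axb. Qed.

Lemma expfam_eta_lt : eta a < eta b.
Proof.
have abT x : x \in `]a, b[ -> Theta x.
  by rewrite in_itv/= => /andP[ax xb]; apply: expfam_itv; rewrite !ltW.
have ceta : {within `[a, b], continuous eta}.
  apply: derivable_within_continuous => x; rewrite in_itv/= => axb.
  by apply: (expfam_derivable_eta hfam); exact: expfam_itv.
apply: (gtr0_derive1_lt_cc _ _ ceta) => //.
- by move=> x /abT; exact: expfam_derivable_eta hfam _.
- by move=> x /abT; exact: expfam_eta_gt0 hfam _.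
- by rewrite in_itv/= lexx ltW.
- by rewrite in_itv/= lexx ltW.
Qed.

(* By Cauchy's mean value theorem the quotient is psi' / eta' at an intermediate
   point, that is, this point itself. *)
Lemma expfam_slope_itv : a < (psi b - psi a) / (eta b - eta a) < b.
Proof.
have cts (g : R -> R) : (forall x, Theta x -> derivable g x 1) ->
    {within `[a, b], continuous g}.
  move=> dg; apply: derivable_within_continuous => x; rewrite in_itv/= => axb.
  by apply: dg; exact: expfam_itv.
have dvb (g : R -> R) : (forall x, Theta x -> derivable g x 1) ->
    forall x, x \in `]a, b[ -> is_derive x 1 g (g^`()%classic x).
  move=> dg x; rewrite in_itv/= => /andP[ax xb].
  rewrite derive1E; apply/derivableP/dg/expfam_itv.
  by rewrite !ltW.
have deta := expfam_derivable_eta hfam; have dpsi := expfam_derivable_psi hfam.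
have [|c] := cauchy_MVT ab (cts _ dpsi) (cts _ deta) (dvb _ dpsi) (dvb _ deta).
  move=> x; rewrite in_itv/= => /andP[ax xb]; rewrite gt_eqF//.
  by apply: (expfam_eta_gt0 hfam); apply: expfam_itv; rewrite !ltW.
rewrite in_itv/= => /andP[ac cb] <-.
by rewrite (expfam_mean hfam) ?ac ?cb//; apply: expfam_itv; rewrite !ltW.
Qed.

(** Isolates the dependence on [n] in a multiple of [1 / n] whose sign is governed by [ln k]; the
    comparisons with [a], [b] and between two values of [n] all start from this form. *)
Lemma sprt_boundE k n : sprt_bound eta psi a b k n =
  (psi b - psi a) / (eta b - eta a) - ln k / (eta b - eta a) / n%:R.
Proof. by rewrite /sprt_bound mulrBl; congr (_ - _); ring. Qed.

Lemma sprt_bound_lt k n : 1 < k -> sprt_bound eta psi a b k n < b.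
Proof.
move=> k1; have /andP[_] := expfam_slope_itv; apply: le_lt_trans.
rewrite sprt_boundE gerBl mulr_ge0 ?invr_ge0 ?ler0n// divr_ge0 ?ln_ge0 ?ltW//.
by rewrite subr_gt0 expfam_eta_lt.
Qed.

Lemma lt_sprt_bound k n : 0 < k < 1 -> a < sprt_bound eta psi a b k n.
Proof.
move=> k01; have /andP[+ _] := expfam_slope_itv; move=> /lt_le_trans; apply.
rewrite sprt_boundE lerDl -mulNr mulr_ge0 ?invr_ge0 ?ler0n// -mulNr.
rewrite divr_ge0 ?oppr_ge0 ?ln_le0 ?ltW//; first by case/andP: k01.
by rewrite subr_gt0 expfam_eta_lt.
Qed.

Let lef_invn m n : (0 < m <= n)%N -> n%:R^-1 <= m%:R^-1 :> R.
Proof.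
by case/andP=> m0 mn; rewrite lef_pV2 ?posrE ?ltr0n ?ler_nat// (leq_trans m0).
Qed.

Lemma sprt_bound_nondecreasing k m n : 1 < k -> (0 < m <= n)%N ->
  sprt_bound eta psi a b k m <= sprt_bound eta psi a b k n.
Proof.
move=> k1 mn; rewrite !sprt_boundE lerD2l lerN2; apply: ler_wpM2l (lef_invn _ _ mn).
by rewrite divr_ge0 ?ln_ge0 ?ltW// subr_gt0 expfam_eta_lt.
Qed.

Lemma sprt_bound_nonincreasing k m n : 0 < k < 1 -> (0 < m <= n)%N ->
  sprt_bound eta psi a b k n <= sprt_bound eta psi a b k m.
Proof.
move=> /andP[k0 k1] mn; rewrite !sprt_boundE lerD2l lerN2.
apply: ler_wnM2l (lef_invn _ _ mn).
by rewrite pmulr_lle0 ?invr_gt0 ?subr_gt0 ?expfam_eta_lt// ln_le0// ltW.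
Qed.

Lemma sprt_ratioE d (T : measurableType d) (X : nat -> {mfun T >-> R}) n w :
  0 < sprt_ratio (expfam_density h eta psi) X a b n w ->
  sprt_ratio (expfam_density h eta psi) X a b n w =
  expR (n%:R * (psi b - psi a) - (eta b - eta a) * \sum_(i < n) X i w).
Proof.
rewrite /sprt_ratio.
have prodE c : \prod_(i < n) expfam_density h eta psi (X i w) c =
    (\prod_(i < n) h (X i w)) * expR (eta c * (\sum_(i < n) X i w)
                                      - n%:R * psi c).
  rewrite big_split/= -expR_sum sumrB -mulr_sumr sumr_const card_ord.
  by rewrite mulr_natl.
rewrite !prodE; set H := \prod_(i < n) _.
(* If the common factor [H] vanishes, the quotient is [0 / 0 = 0], against the positivity
   assumption; otherwise [H] cancels. *)
have [->|H0 _] := eqVneq H 0; first by rewrite !mul0r ltxx.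
rewrite -mulf_div divff// mul1r -expRN -expRD; congr expR; ring.
Qed.

(** The ratio exceeds [k0 > 0], so its exponential form is available and logarithms can be taken.
    The sum enters with a negative coefficient, hence the upper threshold [k1] yields the lower
    bound. *)
Lemma sprt_continue_sum d (T : measurableType d) (X : nat -> {mfun T >-> R})
    k0 k1 n w : (0 < n)%N -> 0 < k0 ->
  sprt_continue (expfam_density h eta psi) X a b k0 k1 n w ->
  n%:R * sprt_bound eta psi a b k1 n < \sum_(i < n) X i w <
  n%:R * sprt_bound eta psi a b k0 n.
Proof.
move=> n0 k00 /andP[]; have n0' : (n%:R : R) != 0 by rewrite pnatr_eq0 -lt0n.
have deta : 0 < eta b - eta a by rewrite subr_gt0 expfam_eta_lt.
set r := sprt_ratio _ _ _ _ _ _ => k0r rk1.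
have r0 : 0 < r by exact: lt_trans k0r.
have k10 : 0 < k1 by exact: lt_trans rk1.
have lnr : ln r = n%:R * (psi b - psi a) - (eta b - eta a) * \sum_(i < n) X i w.
  by rewrite /r sprt_ratioE// expRK.
move: k0r rk1; rewrite -(ltr_ln k00)// -(ltr_ln r0)// lnr => lo hi.
have bE k : n%:R * sprt_bound eta psi a b k n =
    (n%:R * (psi b - psi a) - ln k) / (eta b - eta a).
  by rewrite /sprt_bound mulrA mulrBr mulVKf.
by rewrite !bE ltr_pdivrMr// ltr_pdivlMr//; apply/andP; split; lra.
Qed.

End parameters.

(** * The sample number as an extended-valued random variable, and its expectation *)

Section stopping_time.
Context {R : realType} {d : measure_display} {T : measurableType d}.
Variables (f : R -> R -> R) (X : nat -> {mfun T >-> R}).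
Variables (a b k0 k1 : R).
Local Notation ratio := (sprt_ratio f X a b).
Local Notation continue := (sprt_continue f X a b k0 k1).
Local Notation stop := (sprt_stop f X a b k0 k1).
Local Notation N := (sprt_samples f X a b k0 k1).

Lemma sprt_stop_inj m n w : stop m w -> stop n w -> m = n.
Proof.
move=> [m0 mC mS] [n0 nC nS]; apply/eqP; rewrite eqn_leq.
apply/andP; split; rewrite leqNgt; apply/negP => lt.
- by apply/nS/mC; rewrite n0 lt.
- by apply/mS/nC; rewrite m0 lt.
Qed.

Lemma sprt_samples_stop n w : stop n w -> N w = n%:R%:E.
Proof.
move=> nS; rewrite /sprt_samples.
rewrite [X in ereal_inf X](_ : _ = [set n%:R%:E]) ?ereal_inf1//.
apply/seteqP; split => [_ [k /= kS <-]|_ ->].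
  by rewrite (sprt_stop_inj _ _ _ kS nS).
by exists n.
Qed.

Lemma sprt_samples_nostop w : ~ (exists n, stop n w) -> N w = +oo%E.
Proof.
move=> nS; rewrite /sprt_samples.
rewrite [X in ereal_inf X](_ : _ = set0) ?ereal_inf0//.
by apply/seteqP; split => // _ [k /= kS _]; apply: nS; exists k.
Qed.

Lemma sprt_samples_gtP n w :
  (n%:R%:E < N w)%E <-> forall j, (0 < j <= n)%N -> continue j w.
Proof.
split=> [nN j /andP[j0 jn]|nC].
  apply: contrapT => /asboolPn jC.
  (* The least positive index at which continuation fails is the stopping index, and it is at most
     [j]. *)
  have exC : exists i, (0 < i)%N && ~~ `[< continue i w >].
    by exists j; rewrite j0.
  have [i /andP[i0 iC] imin] := ex_minnP exC.
  have iS : stop i w.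
    split=> [//|l /andP[l0 li]|]; last exact/asboolPn.
    apply: contrapT => /asboolPn lC.
    by move: (imin l); rewrite l0 lC leqNgt li => /(_ isT).
  move: nN; rewrite (sprt_samples_stop _ _ iS) lte_fin ltr_nat ltnNge.
  by rewrite (leq_trans (imin j _))// j0.
have [[i iS]|/sprt_samples_nostop ->] := pselect (exists i, stop i w);
  last exact: ltry.
rewrite (sprt_samples_stop _ _ iS) lte_fin ltr_nat ltnNge; apply/negP => ni.
by have [i0 _] := iS; apply; apply: nC; rewrite i0.
Qed.

Lemma sprt_samples_nneseries w :
  N w = (\sum_(n <oo) (\1_[set w | n%:R%:E < N w]%E w)%:E)%E.
Proof.
have ind0 n : (0 <= (\1_[set w | (n%:R%:E < N w)%E] w)%:E :> \bar R)%E.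
  by rewrite lee_fin.
have [[n nS]|/sprt_samples_nostop noS] := pselect (exists n, stop n w).
  rewrite (nneseries_split 0 n)// add0n eseries0 ?adde0; last first.
    move=> i ni _; rewrite indicE memNset//= (sprt_samples_stop _ _ nS).
    by rewrite lte_fin ltr_nat ltnNge ni.
  rewrite (sprt_samples_stop _ _ nS) sumEFin; congr EFin.
  rewrite big_mkord (eq_bigr (fun=> 1)) ?sumr_const ?card_ord// => i _.
  by rewrite indicE mem_set//= (sprt_samples_stop _ _ nS) lte_fin ltr_nat.
(* Without a stop every indicator is 1, so a partial sum of length [(Num.truncn A).+1] already
   reaches [A]. *)
rewrite noS; apply/esym/eqyP => A A0.
have An : A <= (Num.truncn A).+1%:R by rewrite ltW// truncnS_gt.
rewrite (le_trans _ (nneseries_lim_ge (Num.truncn A).+1 _))//.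
rewrite big_mkord (eq_bigr (fun=> 1%:E)); last first.
  by move=> i _; rewrite indicE mem_set//= noS ltry.
by rewrite sumEFin sumr_const card_ord lee_fin.
Qed.

Hypotheses (mfa : measurable_fun setT (f ^~ a))
  (mfb : measurable_fun setT (f ^~ b)).
Hypothesis fb0 : forall x, 0 <= f x b.

Lemma measurable_sprt_ratio n : measurable_fun setT (ratio n).
Proof.
have mprod c : measurable_fun setT (f ^~ c) ->
    measurable_fun setT (fun w => \prod_(i < n) f (X i w) c).
  move=> mf.
  apply: (@measurable_prod _ _ _ _ _ _ (fun (i : 'I_n) w => f (X i w) c)) => i _.
  exact: (measurableT_comp mf).
apply: measurable_funM; first exact: mprod.
(* On nonnegative reals inversion is the power of exponent -1, also at 0, where both take the value
   0. *)
apply: (@eq_measurable_fun _ _ _ _ _ (fun w => (\prod_(i < n) f (X i w) b) `^ (-1))).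
  by move=> w _; rewrite powR_inv1// prodr_ge0.
exact/(measurableT_comp (measurable_powR _))/mprod.
Qed.

Lemma measurable_sprt_continue n : measurable [set w | continue n w].
Proof.
rewrite (_ : [set w | _] = ratio n @^-1` `]k0, k1[%classic).
  by rewrite -[_ @^-1` _]setTI; apply: measurable_sprt_ratio.
by apply/seteqP; split => w; rewrite /= in_itv.
Qed.

Lemma measurable_sprt_samples_gt n : measurable [set w | (n%:R%:E < N w)%E].
Proof.
rewrite (_ : [set w | _] =
  \bigcap_(j in [set j | (0 < j <= n)%N]) [set w | continue j w]).
  by apply: bigcap_measurableType => j _; exact: measurable_sprt_continue.
apply/seteqP; split => w /=.
  by move=> /sprt_samples_gtP nC j; exact: nC.
by move=> nC; apply/sprt_samples_gtP => j; exact: nC.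
Qed.

Lemma measurable_sprt_stop n : measurable [set w | stop n w].
Proof.
case: n => [|n].
  by rewrite (_ : [set w | _] = set0)//; apply/seteqP; split => // w [].
rewrite (_ : [set w | _] =
  [set w | (n%:R%:E < N w)%E] `&` ~` [set w | continue n.+1 w]).
  apply: measurableI; first exact: measurable_sprt_samples_gt.
  by apply: measurableC; exact: measurable_sprt_continue.
apply/seteqP; split => w /=.
  by move=> [_ nC nS]; split => //; apply/sprt_samples_gtP.
by move=> [/sprt_samples_gtP nC nS]; split.
Qed.

(** Both acceptance events have this form, with [B] a closed half-line. *)
Lemma measurable_sprt_stop_in (B : set R) : measurable B ->
  measurable [set w | exists n, stop n w /\ B (ratio n w)].
Proof.
move=> mB; rewrite (_ : [set w | _] =
    \bigcup_n ([set w | stop n w] `&` ratio n @^-1` B)).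
  apply: bigcup_measurable => n _; apply: measurableI.
    exact: measurable_sprt_stop.
  by rewrite -[_ @^-1` _]setTI; apply: measurable_sprt_ratio.
apply/seteqP; split => w /=; first by move=> [n nB]; exists n.
by move=> [n _ nB]; exists n.
Qed.

Lemma measurable_sprt_accept_H0 : measurable (sprt_accept_H0 f X a b k0 k1).
Proof.
rewrite (_ : sprt_accept_H0 _ _ _ _ _ _ =
  [set w | exists n, stop n w /\ [set` `[k1, +oo[] (ratio n w)]).
  exact: measurable_sprt_stop_in.
by apply/seteqP; split => w [n]; rewrite /= ?in_itv/= ?andbT => nS; exists n;
  rewrite /= ?in_itv/= ?andbT.
Qed.

Lemma measurable_sprt_accept_H1 : measurable (sprt_accept_H1 f X a b k0 k1).
Proof.
rewrite (_ : sprt_accept_H1 _ _ _ _ _ _ =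
  [set w | exists n, stop n w /\ [set` `]-oo, k0]] (ratio n w)]).
  exact: measurable_sprt_stop_in.
by apply/seteqP; split => w [n]; rewrite /= ?in_itv/= => nS; exists n;
  rewrite /= ?in_itv/=.
Qed.

(** Term-by-term integration of the indicator series. The series starts at [n = 0], where the event
    has probability 1. *)
Lemma expectation_sprt_samples (P : probability T R) :
  (\int[P]_w N w = \sum_(n <oo) P [set w | n%:R%:E < N w])%E.
Proof.
under eq_integral do rewrite sprt_samples_nneseries.
rewrite integral_nneseries//.
- apply: eq_eseriesr => n _; rewrite integral_indic// ?setIT//.
  exact: measurable_sprt_samples_gt.
- move=> n; apply/measurable_EFinP/measurable_indic.
  exact: measurable_sprt_samples_gt.
Qed.

(** [A] is covered by its part with [N w <= m] and the event that sampling goes on past [m];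
    subadditivity does the rest. *)
Lemma sprt_accept_truncation (P : probability T R) (A : set T) m (eps : R) :
  measurable A -> (P [set w | m%:R%:E < N w] <= eps%:E)%E ->
  (P (A `&` [set w | N w <= m%:R%:E]) <= P A)%E /\
  (P A <= P (A `&` [set w | N w <= m%:R%:E]) + eps%:E)%E.
Proof.
move=> mA Peps; have mgt := measurable_sprt_samples_gt m.
have mle : measurable [set w | (N w <= m%:R%:E)%E].
  rewrite (_ : [set w | _] = ~` [set w | (m%:R%:E < N w)%E]).
    exact: measurableC.
  by apply/seteqP; split => w /=; rewrite leNgt => /negP.
have mAle : measurable (A `&` [set w | (N w <= m%:R%:E)%E]) by exact: measurableI.
split; first by rewrite le_measure ?inE//; exact: subIsetl.
apply: le_trans (leeD2l _ Peps).
apply: le_trans (measureU2 _ mAle mgt).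
rewrite le_measure ?inE//; first exact: measurableU.
by move=> w Aw /=; case: (leP (N w) m%:R%:E) => h; [left|right].
Qed.

End stopping_time.

(** * Geometric bounds for the tail of the sample number *)

Section sprt_tail.
Context {R : realType} {d : measure_display} {T : measurableType d}.
Variable mu : {sigma_finite_measure set (measurableTypeR R) -> \bar R}.
Variables (Theta : set R) (h eta psi : R -> R).
Hypothesis hfam : exponential_family mu Theta h eta psi.
Variables (P : probability T R) (X : nat -> {mfun T >-> R}) (theta : R).
Hypothesis thetaT : Theta theta.
Hypothesis hX :
  iid_with_density mu P X (fun x => expfam_density h eta psi x theta).
Variables a b k0 k1 : R.
Hypotheses (aT : Theta a) (bT : Theta b) (ab : a < b).
Hypotheses (k001 : 0 < k0 < 1) (k11 : 1 < k1).
Local Notation f := (expfam_density h eta psi).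
Local Notation N := (sprt_samples f X a b k0 k1).

Lemma sprt_tail_chernoff_upper m n : (0 < m <= n)%N ->
  theta < sprt_bound eta psi a b k1 m ->
  (P [set w | n%:R%:E < N w] <=
   (chernoff_ratio eta psi theta (sprt_bound eta psi a b k1 m) ^+ n)%:E)%E.
Proof.
set u := sprt_bound _ _ _ _ _ _ => mn thu.
have n0 : (0 < n)%N by case/andP: mn => /leq_trans; apply.
have uT : Theta u.
  apply: (expfam_itv _ _ _ _ _ hfam _ _ thetaT bT).
  by rewrite !ltW ?(sprt_bound_lt _ _ _ _ _ hfam).
apply: (expfam_chernoff _ _ _ _ _ hfam _ _ _ _ _ _ _ _ uT hX).
  apply: measurable_sprt_samples_gt.
  - exact: measurable_expfam_density hfam _.
  - exact: measurable_expfam_density hfam _.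
  - by move=> x; exact: expfam_density_ge0 hfam _ _.
move=> w /sprt_samples_gtP /(_ n) nC.
have k00 : 0 < k0 by case/andP: k001.
have /andP[lo _] := sprt_continue_sum _ _ _ _ _ hfam _ _ aT bT ab _ _ _ _ _ _ _
  n0 k00 (nC ltac:(by rewrite n0 leqnn)).
(* Both factors are positive: [theta < u] gives the first, and the sum exceeds n u(n), which is at
   least n u(m). *)
rewrite mulr_ge0// ?subr_ge0 ltW//.
  exact: (expfam_eta_lt _ _ _ _ _ hfam _ _ thetaT uT).
apply: le_lt_trans lo; rewrite ler_wpM2l//.
exact: (sprt_bound_nondecreasing _ _ _ _ _ hfam).
Qed.

Lemma sprt_tail_chernoff_lower m n : (0 < m <= n)%N ->
  sprt_bound eta psi a b k0 m < theta ->
  (P [set w | n%:R%:E < N w] <=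
   (chernoff_ratio eta psi theta (sprt_bound eta psi a b k0 m) ^+ n)%:E)%E.
Proof.
set v := sprt_bound _ _ _ _ _ _ => mn vth.
have n0 : (0 < n)%N by case/andP: mn => /leq_trans; apply.
have vT : Theta v.
  apply: (expfam_itv _ _ _ _ _ hfam _ _ aT thetaT).
  by rewrite !ltW ?(lt_sprt_bound _ _ _ _ _ hfam).
apply: (expfam_chernoff _ _ _ _ _ hfam _ _ _ _ _ _ _ _ vT hX).
  apply: measurable_sprt_samples_gt.
  - exact: measurable_expfam_density hfam _.
  - exact: measurable_expfam_density hfam _.
  - by move=> x; exact: expfam_density_ge0 hfam _ _.
move=> w /sprt_samples_gtP /(_ n) nC.
have k00 : 0 < k0 by case/andP: k001.
have /andP[_ hi] := sprt_continue_sum _ _ _ _ _ hfam _ _ aT bT ab _ _ _ _ _ _ _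
  n0 k00 (nC ltac:(by rewrite n0 leqnn)).
(* Here both factors are negative, since [v < theta] and the sum stays below n v(n), which is at
   most n v(m). *)
rewrite mulr_le0// ?subr_le0 ltW//.
  exact: (expfam_eta_lt _ _ _ _ _ hfam _ _ vT thetaT).
apply: lt_le_trans hi _; rewrite ler_wpM2l//.
exact: (sprt_bound_nonincreasing _ _ _ _ _ hfam).
Qed.

End sprt_tail.

(** * Summation of the geometric tail and conclusion *)

Lemma nneseries_geometric_tail (R : realType) (p : nat -> \bar R) (c eps : R) m :
  (forall n, 0 <= p n)%E -> (forall n, (m <= n)%N -> (p n <= (c ^+ n)%:E)%E) ->
  0 < eps -> 0 < c -> c ^+ m < eps * (1 - c) ->
  (\sum_(0 <= n < m) p n <= \sum_(n <oo) p n)%E /\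
  (\sum_(n <oo) p n <= \sum_(0 <= n < m) p n + eps%:E)%E.
Proof.
move=> p0 pc eps0 c0 cm.
(* The smallness condition itself forces [c < 1], as its left side is positive. *)
have c1 : 0 < 1 - c.
  by rewrite -(pmulr_rgt0 _ eps0) (lt_trans _ cm)// exprn_gt0.
split; first exact: nneseries_lim_ge.
rewrite (nneseries_split 0 m)// add0n leeD2l//.
apply: lime_le.
  by apply: is_cvg_ereal_nneg_natsum => n _.
apply: nearW => n; have [nm|/ltnW/subnKC <-] := leqP n m.
  by rewrite big_geq// lee_fin ltW.
apply: (@le_trans _ _ (\sum_(m <= i < m + (n - m)) (c ^+ i)%:E)%E).
  rewrite big_nat_cond [leRHS]big_nat_cond.
  by apply: lee_sum => i /andP[/andP[/pc]].
rewrite sumEFin geometric_partial_tail lee_fin.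
(* The tail from [m] on is at most [c ^+ m / (1 - c)], which the condition bounds by [eps]. *)
apply: le_trans (geometric_le_lim _ _ c0 _) _.
- by rewrite exprn_ge0 ?ltW.
- by rewrite ger0_norm ?ltW// -subr_gt0.
- by rewrite ler_pdivrMr// ltW.
Qed.

Theorem theorem12 (R : realType) (d : measure_display) (T : measurableType d)
  (mu : {sigma_finite_measure set (measurableTypeR R) -> \bar R})
  (Theta : set R) (h eta psi : R -> R)
  (hfam : exponential_family mu Theta h eta psi)
  (Pr : R -> probability T R) (X : nat -> {mfun T >-> R})
  (hX : forall theta, Theta theta ->
    iid_with_density mu (Pr theta) X
      (fun x => expfam_density h eta psi x theta))
  (theta0 theta1 : R) (htheta0 : Theta theta0) (htheta1 : Theta theta1)
  (htheta01 : theta0 < theta1)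
  (k0 k1 : R) (hk0 : 0 < k0 < 1) (hk1 : 1 < k1)
  (m : nat) (hm : (0 < m)%N) (theta : R) (htheta : Theta theta)
  (eps : R) (heps : 0 < eps) :
  let f := expfam_density h eta psi in
  let N := sprt_samples f X theta0 theta1 k0 k1 in
  let AcceptH0 := sprt_accept_H0 f X theta0 theta1 k0 k1 in
  let AcceptH1 := sprt_accept_H1 f X theta0 theta1 k0 k1 in
  let u := sprt_bound eta psi theta0 theta1 k1 m in
  let v := sprt_bound eta psi theta0 theta1 k0 m in
  let c := chernoff_ratio eta psi theta in
  (((theta < u /\ c u ^+ m < eps) \/ (theta > v /\ c v ^+ m < eps)) ->
    [/\ (Pr theta (AcceptH0 `&` [set w | N w <= m%:R%:E]) <=
           Pr theta AcceptH0)%E,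
        (Pr theta AcceptH0 <=
           Pr theta (AcceptH0 `&` [set w | N w <= m%:R%:E]) + eps%:E)%E,
        (Pr theta (AcceptH1 `&` [set w | N w <= m%:R%:E]) <=
           Pr theta AcceptH1)%E &
        (Pr theta AcceptH1 <=
           Pr theta (AcceptH1 `&` [set w | N w <= m%:R%:E]) + eps%:E)%E])
  /\
  (((theta < u /\ c u ^+ m < eps * (1 - c u)) \/
    (theta > v /\ c v ^+ m < eps * (1 - c v))) ->
    (\sum_(0 <= n < m) Pr theta [set w | n%:R%:E < N w] <=
       \int[Pr theta]_w N w)%E /\
    (\int[Pr theta]_w N w <=
       \sum_(0 <= n < m) Pr theta [set w | n%:R%:E < N w] + eps%:E)%E).
Proof.
move=> f N AcceptH0 AcceptH1 u v c.
have [k00 _] := andP hk0.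
have hXt := hX theta htheta.
have mf z : measurable_fun setT (f ^~ z) by exact: measurable_expfam_density hfam _.
have f0 x z : 0 <= f x z by exact: expfam_density_ge0 hfam _ _.
have up n : (m <= n)%N -> theta < u ->
    (Pr theta [set w | n%:R%:E < N w] <= (c u ^+ n)%:E)%E.
  move=> mn; apply: (sprt_tail_chernoff_upper _ _ _ _ _ hfam _ _ _ htheta hXt) => //.
  by rewrite hm.
have lo n : (m <= n)%N -> v < theta ->
    (Pr theta [set w | n%:R%:E < N w] <= (c v ^+ n)%:E)%E.
  move=> mn; apply: (sprt_tail_chernoff_lower _ _ _ _ _ hfam _ _ _ htheta hXt) => //.
  by rewrite hm.
split => [H|H].
  (* Either alternative makes the probability of sampling past [m] at most [eps]; this one bound
     serves both decisions. *)
  have tail : (Pr theta [set w | m%:R%:E < N w] <= eps%:E)%E.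
    case: H => -[th ceps].
    - by apply: le_trans (up _ _ th) _; rewrite ?lee_fin ?ltW.
    - by apply: le_trans (lo _ _ th) _; rewrite ?lee_fin ?ltW.
  have trunc A : measurable A -> _ :=
    fun mA => sprt_accept_truncation _ _ _ _ _ _ (mf _) (mf _) (f0 ^~ _)
                _ A _ _ mA tail.
  have [? ?] := trunc _ (measurable_sprt_accept_H0 f X theta0 theta1 k0 k1
    (mf _) (mf _) (f0 ^~ _)).
  have [? ?] := trunc _ (measurable_sprt_accept_H1 f X theta0 theta1 k0 k1
    (mf _) (mf _) (f0 ^~ _)).
  by split.
rewrite (expectation_sprt_samples f X theta0 theta1 k0 k1 (mf _) (mf _) (f0 ^~ _)).
have c_gt0 z : 0 < c z by rewrite /c chernoff_ratioE expR_gt0.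
by case: H => -[th ceps]; apply: nneseries_geometric_tail ceps => //;
  move=> n mn; [exact: up|exact: lo].
Qed.
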